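(* Consider the following randomness-generation protocol. Inputs: an integer $k_{\text{out}}\ge 1$ and a soundness error $\epsilon\in(0,1]$. Given: a maximum number of blocks $N_b$; a power $\beta>0$; for each block $i\in\{1,\dots,N_b\}$ a block PEF $G_i$ with power $\beta$ for the block model $\mathcal{C}$, fixed before block $i$ is acquired; and a function $\mathcal{E}$ (the extractor). Let $m_{\text{in}}=N_b\cdot 2^k\cdot 2$. The protocol: (1) chooses $(\sigma_{\text{in}},d_{\text{s}},\epsilon_{\text{ext}})$ such that $\epsilon_{\text{ext}}<\epsilon$, $\mathcal{E}$ is a classical-proof strong extractor with parameters $(m_{\text{in}},d_{\text{s}},k_{\text{out}},\sigma_{\text{in}},\epsilon_{\text{ext}})$, and $\sigma_{\text{in}}\le m_{\text{in}}+\frac{1+\beta}{\beta}\log_2(\epsilon)$ (such a choice is assumed to exist); (2) obtains a uniformly random seed $s$ of $d_{\text{s}}$ bits, independent of everything else; (3) sets $\epsilon_{\text{en}}=\epsilon-\epsilon_{\text{ext}}$, $q=2^{-\sigma_{\text{in}}}\epsilon$, $t_{\min}=1/(q^{\beta}\epsilon_{\text{en}})$ and $t=1$; (4) for $i=1,\dots,N_b$: acquires block $i$ with observed inputs $\mathbf{z}_i$ and outputs $\mathbf{c}_i$ (of actual length $l_i$), updates $t\leftarrow t\cdot G_i(\mathbf{c}_i\mathbf{z}_i)$, sets $\mathbf{c}'_i$ to be $\mathbf{c}_i$ padded with $2(2^k-l_i)$ zeros; if $t\ge t_{\min}$, it stops acquiring blocks, sets $\mathbf{c}'_j$ to the all-zero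 string of length $2\cdot 2^k$ for $j=i+1,\dots,N_b$, and returns $P=1$, $R=\mathcal{E}((\mathbf{c}'_1,\dots,\mathbf{c}'_{N_b}),s)$, $S'=s$; (5) if after $N_b$ blocks $t<t_{\min}$, it returns $P=0$, $R=0^{k_{\text{out}}}$, $S'=s$. Then this protocol is $\epsilon$-sound for the model $\mathcal{H}$, i.e. for every joint distribution $\mu$ of the experiment inputs $\vec{\mathbf{Z}}$, outputs $\vec{\mathbf{C}}$ and classical side information $E$ satisfying $\mathcal{H}$, there exists a distribution $\nu(\vec{\mathbf{Z}}E)$ such that $$\mathrm{TV}\big(\pi_\mu(RS'\vec{\mathbf{Z}}E\mid P=1),\ \tau(RS')\,\nu(\vec{\mathbf{Z}}E)\big)\,\mathbb{P}_\mu(P=1)\le\epsilon,$$ where $\pi_\mu$ is the joint distribution of the protocol outputs, inputs and side information induced by $\mu$, and $\tau(RS')$ is the uniform distribution on the values of $(R,S')$.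
   Context: Experiment structure: a sequence of blocks. Each block has a length $L$ uniformly distributed on $\{1,\dots,2^k\}$ (with $k\ge1$ fixed); trial $j\le L$ of a block has inputs $Z_j=X_jY_j\in\{0,1\}^2$ and outputs $C_j=A_jB_j\in\{0,1\}^2$; the last trial (trial $L$) is the spot-checking trial with uniformly random inputs, the other trials have inputs $X_j=Y_j=0$. For the analysis, trials $j>L$ are ''virtual'' with $C_j=Z_j=*$; $\mathbf{C},\mathbf{Z}$ denote the length-$2^k$ sequences of a block. Trial models: $\mathcal{T}$ is the set of conditional distributions $\mu(C\mid Z)$ of $C=AB\in\{0,1\}^2$ given $Z=XY\in\{0,1\}^2$ satisfying non-signaling ($\sum_b\mu(ab|xy)$ independent of $y$, $\sum_a\mu(ab|xy)$ independent of $x$) and Tsirelson's bounds ($|E_{00}+E_{01}+E_{10}+E_{11}-2E_{x'y'}|\le 2\sqrt2$ for all $x'y'$, where $E_{xy}=\sum_{a,b}(-1)^{a+b}\mu(ab|xy)$). With $q_j=1/(2^k-j+1)$, $\nu_j$ is the distribution on $Z$ with $\nu_j(00)=1-3q_j/4$ and $\nu_j(xy)=q_j/4$ for $xy\ne00$. $\mathcal{M}_j^{(r)}$ is the set of distributions $\nu_j(Z)\mu(C|Z)$ with $\mu(C|Z)\in\mathcal{T}$. Block model $\mathcal{C}$: the set of distributions of $(\mathbf{C},\mathbf{Z})$ of a block such that, for each $j$, conditional on the previous results $\mathbf{C}_{<j}\mathbf{Z}_{<j}$ and on $L\ge j$, the distribution of $C_jZ_j$ lies in $\mathcal{M}_j^{(r)}$;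 conditional on $L<j$, $C_jZ_j=**$ deterministically; and given $Z_j=00$ and $L\ge j$ the trial is the last one with probability $1/(2^k-j+1)$, while $Z_j\ne 00$ means the block ends at trial $j$. The model $\mathcal{H}$ for the whole experiment is obtained by chaining: conditional on all previous blocks' results, each block's results have a distribution in $\mathcal{C}$. A joint distribution $\mu(\vec{\mathbf{C}}\vec{\mathbf{Z}}E)$ satisfies $\mathcal{H}$ if for each value $e$ of the classical side information $E$, $\mu(\vec{\mathbf{C}}\vec{\mathbf{Z}}\mid e)\in\mathcal{H}$. Block PEF: a non-negative function $G$ of $(\mathbf{c},\mathbf{z})$ with $\sum_{\mathbf{c},\mathbf{z}}\mu(\mathbf{c},\mathbf{z})G(\mathbf{c}\mathbf{z})\mu(\mathbf{c}\mid\mathbf{z})^{\beta}\le1$ for all $\mu\in\mathcal{C}$. Total variation: $\mathrm{TV}(\mu,\nu)=\frac12\sum_x|\mu(x)-\nu(x)|$. Conditional min-entropy: $H_{\min}(C|E)_\mu=-\log_2\sum_e\mu(e)\max_c\mu(c|e)$. A function $\mathcal{E}:(C,S)\mapsto R$ with $C$ an $m_{\text{in}}$-bit string, $S$ a $d_{\text{s}}$-bit seed, $R$ a $k_{\text{out}}$-bit string, is a classical-proof strong extractor with parameters $(m_{\text{in}},d_{\text{s}},k_{\text{out}},\sigma_{\text{in}},\epsilon_{\text{ext}})$ if for every distribution $\mu(CE)$ with $H_{\min}(C|E)_\mu\ge\sigma_{\text{in}}$ and $S$ uniform and independent of $(C,E)$, the resulting distribution $\pi_\mu(RSE)$ satisfies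 $\mathrm{TV}(\pi_\mu(RSE),\tau(RS)\mu(E))\le\epsilon_{\text{ext}}$, with $\tau(RS)$ uniform.
   Formalization: In the block model, trial j is last with probability 1/(2^k-j+1) given the past and L≥j, rather than given also Z_j=00, since the latter contradicts L being uniform and the form of ν_j (k=1 would give P(L=1)=11/16); side information E takes finitely many values. *)

(* Defs.v *)
From HB Require Import structures.
From mathcomp Require Import all_boot all_order all_algebra.
From mathcomp Require Import reals exp.
Set Implicit Arguments. Unset Strict Implicit. Unset Printing Implicit Defensive.
Import Order.TTheory GRing.Theory Num.Theory.
Local Open Scope ring_scope.

(* a pair of bits: C = AB (a, b) or Z = XY (x, y) *)
Definition bit2 := (bool * bool)%type.
(* result of one trial: (C_j, Z_j); None encodes the virtual value '*' *)
Definition trial := (option bit2 * option bit2)%type.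
Definition star : trial := (None, None).
Definition block (k : nat) := {ffun 'I_(2 ^ k) -> trial}.
Definition blen k (b : block k) : nat := #|[pred j | b j != star]|.
Definition zseq k (b : block k) : {ffun 'I_(2 ^ k) -> option bit2} :=
  [ffun j => (b j).2].

Definition bits (n : nat) := {ffun 'I_n -> bool}.

Section Defs.
Variable R : realType.

Definition is_dist (T : finType) (p : T -> R) : Prop :=
  (forall x, 0 <= p x) /\ \sum_(x : T) p x = 1.
Definition Pr (T : finType) (p : T -> R) (A : pred T) : R := \sum_(x | A x) p x.

Definition log2 (x : R) : R := ln x / ln 2.

Definition TV (T : finType) (p q : T -> R) : R :=
  2^-1 * \sum_(x : T) `|p x - q x|.

(* m c z = mu(c | z) *)
Definition corr (m : bit2 -> bit2 -> R) (z : bit2) : R :=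
  \sum_(c : bit2) (-1) ^+ (c.1 + c.2)%N * m c z.

Definition in_T (m : bit2 -> bit2 -> R) : Prop :=
  (forall z, is_dist (fun c => m c z)) /\
  (forall a x y y', \sum_(b : bool) m (a, b) (x, y) = \sum_(b : bool) m (a, b) (x, y')) /\
  (forall b x x' y, \sum_(a : bool) m (a, b) (x, y) = \sum_(a : bool) m (a, b) (x', y)) /\
  (forall z', `| corr m (false, false) + corr m (false, true) + corr m (true, false)
                 + corr m (true, true) - 2 * corr m z' | <= 2 * Num.sqrt 2).

(* q_j = 1/(2^k - j + 1) for trial j = i+1 (0-based index i) *)
Definition qj (k : nat) (i : 'I_(2 ^ k)) : R := ((2 ^ k - i)%N%:R)^-1.
Definition nuj (k : nat) (i : 'I_(2 ^ k)) (z : bit2) : R :=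
  if z == (false, false) then 1 - 3 * qj i / 4 else qj i / 4.

Definition prefix_eq k (b h : block k) (i : 'I_(2 ^ k)) : bool :=
  [forall j : 'I_(2 ^ k), (j < i)%N ==> (b j == h j)].

Definition in_C (k : nat) (mu : block k -> R) : Prop :=
  is_dist mu /\
  Pr mu (fun b => blen b == 0%N) = 0 /\
  (forall (i : 'I_(2 ^ k)) (h : block k),
     Pr mu (fun b => prefix_eq b h i && (i < blen b)%N) != 0 ->
     exists m, in_T m /\
       forall c z,
         Pr mu (fun b => [&& prefix_eq b h i, (i < blen b)%N & b i == (Some c, Some z)])
         = nuj i z * m c z * Pr mu (fun b => prefix_eq b h i && (i < blen b)%N)) /\
  (forall i : 'I_(2 ^ k), Pr mu (fun b => (blen b <= i)%N && (b i != star)) = 0) /\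
  (forall (i : 'I_(2 ^ k)) (h : block k),
     Pr mu (fun b => [&& prefix_eq b h i, (i < blen b)%N & blen b == i.+1])
     = qj i * Pr mu (fun b => prefix_eq b h i && (i < blen b)%N)) /\
  (forall i : 'I_(2 ^ k),
     Pr mu (fun b => [&& (i < blen b)%N, (b i).2 != Some (false, false) & blen b != i.+1]) = 0).

Definition condCZ k (mu : block k -> R) (b : block k) : R :=
  mu b / \sum_(b' : block k | zseq b' == zseq b) mu b'.

Definition block_PEF (k : nat) (beta : R) (G : block k -> R) : Prop :=
  (forall b, 0 <= G b) /\
  forall mu : block k -> R, in_C mu ->
    \sum_(b : block k) mu b * G b * (condCZ mu b) `^ beta <= 1.

Definition vec (Nb k : nat) := {ffun 'I_Nb -> block k}.
Definition zvec (Nb k : nat) := {ffun 'I_Nb -> {ffun 'I_(2 ^ k) -> option bit2}}.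
Definition zvec_of Nb k (v : vec Nb k) : zvec Nb k := [ffun i => zseq (v i)].

Definition vprefix_eq Nb k (v h : vec Nb k) (i : 'I_Nb) : bool :=
  [forall j : 'I_Nb, (j < i)%N ==> (v j == h j)].

Definition in_H (Nb k : nat) (E : finType) (mu : vec Nb k * E -> R) : Prop :=
  is_dist mu /\
  forall (e : E) (i : 'I_Nb) (h : vec Nb k),
    Pr mu (fun x => (x.2 == e) && vprefix_eq x.1 h i) != 0 ->
    exists rho : block k -> R, in_C rho /\
      forall b, Pr mu (fun x => [&& x.2 == e, vprefix_eq x.1 h i & x.1 i == b])
                = Pr mu (fun x => (x.2 == e) && vprefix_eq x.1 h i) * rho b.

Definition condP (C E : finType) (mu : C * E -> R) (c : C) (e : E) : R :=
  mu (c, e) / \sum_(c' : C) mu (c', e).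

Definition Hmin (C E : finType) (mu : C * E -> R) : R :=
  - log2 (\sum_(e : E) (\sum_(c : C) mu (c, e)) *
                       \big[Num.max/0]_(c : C) condP mu c e).

Definition strong_extractor (m ds kout : nat) (Ext : bits m -> bits ds -> bits kout)
    (sigma eps_ext : R) : Prop :=
  forall (E : finType) (mu : bits m * E -> R),
    is_dist mu -> sigma <= Hmin mu ->
    TV (fun y : (bits kout * bits ds) * E =>
          \sum_(c : bits m) mu (c, y.2) * ((2 : R) ^+ ds)^-1
                            * (Ext c y.1.2 == y.1.1)%:R)
       (fun y : (bits kout * bits ds) * E =>
          ((2 : R) ^+ (kout + ds))^-1 * \sum_(c : bits m) mu (c, y.2))
    <= eps_ext.

Definition trial_bits (t : trial) : seq bool :=
  if t.1 is Some (a, b) then [:: a; b] else [:: false; false].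
(* c'_i : the block outputs padded with zeros (virtual trials give 00) *)
Definition block_bits k (b : block k) : seq bool :=
  flatten [seq trial_bits (b j) | j <- enum 'I_(2 ^ k)].

Section Protocol.
Variables (Nb k kout ds : nat) (beta eps sigma eps_ext : R).
Variable G : 'I_Nb -> seq (block k) -> block k -> R.
Variable Ext : bits (Nb * 2 ^ k * 2) -> bits ds -> bits kout.

Definition eps_en : R := eps - eps_ext.
Definition qpar : R := 2 `^ (- sigma) * eps.
Definition tmin : R := (qpar `^ beta * eps_en)^-1.

(* the results of the blocks before block i (the data available when G_i is fixed) *)
Definition hist (v : vec Nb k) (i : 'I_Nb) : seq (block k) :=
  map v (filter (fun j : 'I_Nb => (j < i)%N) (enum 'I_Nb)).
Definition tval (v : vec Nb k) (i : 'I_Nb) : R :=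
  \prod_(j : 'I_Nb | (j <= i)%N) G j (hist v j) (v j).
Definition stopped_before (v : vec Nb k) (j : 'I_Nb) : bool :=
  [exists i : 'I_Nb, (i < j)%N && (tmin <= tval v i)].
Definition accept (v : vec Nb k) : bool := [exists i : 'I_Nb, tmin <= tval v i].
Definition cprime (v : vec Nb k) : bits (Nb * 2 ^ k * 2) :=
  [ffun p : 'I_(Nb * 2 ^ k * 2) => nth false
     (flatten [seq (if stopped_before v j then nseq (2 * 2 ^ k) false
                    else block_bits (v j)) | j <- enum 'I_Nb]) (nat_of_ord p)].
Definition prot_out (v : vec Nb k) (s : bits ds) : bool * bits kout * bits ds :=
  if accept v then (true, Ext (cprime v) s, s) else (false, [ffun => false], s).

Definition pi_mu (E : finType) (mu : vec Nb k * E -> R)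
    (p : bool) (r : bits kout) (s' : bits ds) (zv : zvec Nb k) (e : E) : R :=
  \sum_(x : vec Nb k * E) \sum_(s : bits ds)
     mu x * ((2 : R) ^+ ds)^-1 *
     ((prot_out x.1 s == (p, r, s')) && (zvec_of x.1 == zv) && (x.2 == e))%:R.

Definition prob_pass (E : finType) (mu : vec Nb k * E -> R) : R :=
  \sum_(y : (bits kout * bits ds) * (zvec Nb k * E))
     pi_mu mu true y.1.1 y.1.2 y.2.1 y.2.2.

Definition eps_sound : Prop :=
  forall (E : finType) (mu : vec Nb k * E -> R), in_H mu ->
    exists nu : zvec Nb k * E -> R, is_dist nu /\
      TV (fun y : (bits kout * bits ds) * (zvec Nb k * E) =>
            pi_mu mu true y.1.1 y.1.2 y.2.1 y.2.2 / prob_pass mu)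
         (fun y : (bits kout * bits ds) * (zvec Nb k * E) =>
            ((2 : R) ^+ (kout + ds))^-1 * nu y.2)
      * prob_pass mu <= eps.
End Protocol.
End Defs.

(* Main.v *)
Require Import Defs.
From HB Require Import structures.
From mathcomp Require Import all_boot all_order all_algebra.
From mathcomp Require Import reals exp.
From mathcomp Require Import boolp.
From mathcomp Require Import ring lra.
Import Order.TTheory GRing.Theory Num.Theory.
Local Open Scope ring_scope.

(* Every distribution in the block model has the same input marginal, since
   each of the 2^k * 4 pairs (length, last input) has probability 1/(4 * 2^k).
   Hence the inputs are independent of the past, and for a passing run the
   probability of the padded outputs given all inputs and E is the product K
   of the one-block conditionals mu(c_i | z_i, past) over the blocks up to the
   stop. The stopped product of the G_i times K^beta has expectation at most 1,
   so by Markov's inequality passing with K >= q has probability at most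
   eps_en. What is left has each conditional probability below q; refilling
   the removed mass under the same cap (possible since 2^m_in * q >= 1) and
   conditioning on passing, an event of probability at least eps (otherwise
   the claim is trivial), gives min-entropy at least sigma_in, and the
   extractor applies. *)

Set Implicit Arguments.
Unset Strict Implicit.

(** * Input distribution of a block *)

Section FiniteMeasure.
Variables (R : realType) (T : finType) (mu : T -> R).
Hypothesis mu0 : forall x, 0 <= mu x.

Lemma Pr_null A x : Pr mu A = 0 -> A x -> mu x = 0.
Proof. by move=> h Ax; apply: (psumr_eq0P _ h). Qed.

Lemma Pr_ae (A B : pred T) :
  (forall x, mu x != 0 -> A x = B x) -> Pr mu A = Pr mu B.
Proof.
move=> h; rewrite /Pr big_mkcond [RHS]big_mkcond /=; apply: eq_bigr => x _.
by case: (eqVneq (mu x) 0) => [->|/h ->//]; rewrite !if_same.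
Qed.

Lemma PrID (A B : pred T) :
  Pr mu A = Pr mu (fun x => A x && B x) + Pr mu (fun x => A x && ~~ B x).
Proof. by rewrite /Pr (bigID B). Qed.

(** The index is required to be unique only on the support of [mu], because the block model
    constrains results only up to null sets. *)
Lemma Pr_sum_unique (I : finType) (A : pred T) (Q : I -> pred T) :
  (forall x, mu x != 0 -> A x -> exists p, forall p', Q p' x = (p' == p)) ->
  Pr mu A = \sum_p Pr mu (fun x => A x && Q p x).
Proof.
move=> h; rewrite /Pr big_mkcond /=.
under [RHS]eq_bigr => p _ do rewrite big_mkcond /=.
rewrite exchange_big /=; apply: eq_bigr => x _.
case: (eqVneq (mu x) 0) => [->|nz]; first by rewrite if_same big1 // => p _; rewrite if_same.
case Ax : (A x) => /=; last by rewrite big1.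
have [p hp] := h x nz Ax.
by rewrite -big_mkcond /= (eq_bigl _ _ hp) big_pred1_eq.
Qed.

(** Removes the conditioning on a history: [f] will truncate a block to its past. Fibres over values
    that [f] does not take are empty, so it suffices to treat values [f h]. *)
Lemma Pr_fibers (U : finType) (f : T -> U) (A B : pred T) (c : R) :
  (forall h, Pr mu (fun x => (f x == f h) && A x) =
             c * Pr mu (fun x => (f x == f h) && B x)) ->
  Pr mu A = c * Pr mu B.
Proof.
move=> h.
have E (C : pred T) : Pr mu C = \sum_u Pr mu (fun x => C x && (f x == u)).
  by apply: Pr_sum_unique => x _ _; exists (f x) => u; rewrite eq_sym.
rewrite (E A) (E B) mulr_sumr; apply: eq_bigr => u _.
have [x /eqP <-|nou] := pickP (fun x => f x == u).
  by have := h x; rewrite /Pr; under eq_bigl do rewrite andbC;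
     under [X in _ = _ * X]eq_bigl do rewrite andbC.
by rewrite /Pr !big1 ?mulr0 // => x; rewrite nou andbF.
Qed.
End FiniteMeasure.

(** * Length, last input and input marginal of one block *)

Section BlockInputs.
Variables (R : realType) (k : nat).
Implicit Types (b h : block k) (i : 'I_(2 ^ k)).

(** The type [trial] also contains half-virtual results such as [(Some c, None)]. Excluding them
    makes the outputs decodable from their padded bits and the inputs. *)
Definition wf_block b := [forall i, (b i == star) || (b i).1 && (b i).2].

Definition input_pattern i (z : bit2) : {ffun 'I_(2 ^ k) -> option bit2} :=
  [ffun j : 'I_(2 ^ k) => if (j < i)%N then Some (false, false) else
             if j == i then Some z else None].

(** Image under [input_pattern] of the uniform distribution on the [2 ^ k * 4] pairs (index of the
    last trial, last input). *)
Definition input_dist (z : {ffun 'I_(2 ^ k) -> option bit2}) : R :=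
  \sum_(p : 'I_(2 ^ k) * bit2) (input_pattern p.1 p.2 == z)%:R * (4 * 2 ^+ k)^-1.

Lemma input_dist_ge0 z : 0 <= input_dist z.
Proof.
by apply: sumr_ge0 => p _; rewrite mulr_ge0 // invr_ge0 mulr_ge0 // exprn_ge0.
Qed.

Lemma sum_bit2 (f : bit2 -> R) : \sum_z f z =
  f (false, false) + f (false, true) + f (true, false) + f (true, true).
Proof.
transitivity (\sum_(x : bool) \sum_(y : bool) f (x, y)); last by rewrite !big_bool /=; ring.
by rewrite pair_bigA; apply: eq_bigr => -[].
Qed.

Lemma prefix_eqE b h i : prefix_eq b h i =
  ([ffun j : 'I_(2 ^ k) => if (j < i)%N then b j else star] ==
   [ffun j : 'I_(2 ^ k) => if (j < i)%N then h j else star]).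
Proof.
apply/forallP/eqP => [H|/ffunP H j].
  by apply/ffunP => j; rewrite !ffunE; case: ifP => // ji; move: (H j); rewrite ji => /eqP.
by apply/implyP => ji; move: (H j); rewrite !ffunE ji => ->.
Qed.

Variables (mu : block k -> R).
Hypothesis muC : in_C mu.

Lemma in_C_ge0 b : 0 <= mu b. Proof. by case: muC => -[]. Qed.
Let mu0 := in_C_ge0.

Lemma Pr_alive_last i :
  Pr mu (fun b => blen b == i.+1) = qj R i * Pr mu (fun b => (i < blen b)%N).
Proof.
case: muC => _ [_ [_ [_ [H _]]]].
rewrite -(@Pr_fibers _ _ _ _
  (fun b => [ffun j : 'I_(2 ^ k) => if (j < i)%N then b j else star])
  (fun b => (i < blen b)%N && (blen b == i.+1))) => [|h].
  by apply: eq_bigl => b; case: eqP => [->|]; rewrite ?ltnS ?leqnn ?andbF.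
transitivity (Pr mu (fun b => [&& prefix_eq b h i, (i < blen b)%N & blen b == i.+1])).
  by apply: eq_bigl => b; rewrite prefix_eqE.
by rewrite H; congr (_ * _); apply: eq_bigl => b; rewrite prefix_eqE.
Qed.

(** The model gives the mass of results [(Some c, Some z)] only, hence the requirement that the
    output be present. Summing [m c z] over [c] gives 1, and [Pr_fibers] removes the history. *)
Lemma Pr_alive_input i z :
  Pr mu (fun b => [&& (i < blen b)%N, (b i).1 : bool & (b i).2 == Some z]) =
  nuj R i z * Pr mu (fun b => (i < blen b)%N).
Proof.
case: muC => _ [_ [H _]].
apply: (@Pr_fibers _ _ _ _
  (fun b => [ffun j : 'I_(2 ^ k) => if (j < i)%N then b j else star])) => h.
under [X in X = _]eq_bigl => b do rewrite -prefix_eqE.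
under [X in _ = _ * X]eq_bigl => b do rewrite -prefix_eqE.
rewrite -!/(Pr _ _).
case: (eqVneq (Pr mu (fun b => prefix_eq b h i && (i < blen b)%N)) 0) => [h0|nz].
  rewrite [X in _ = _ * X]h0 mulr0; apply: big1 => b /and4P[b1 b2 _ _].
  by apply: (Pr_null mu0 h0); rewrite b1.
have [m [[dm _] mH]] := H i h nz.
rewrite (@Pr_sum_unique _ _ _ bit2 _ (fun c b => b i == (Some c, Some z))); last first.
  move=> b _ /and4P[_ _]; case: (b i) => -[c|] // o2 _ /eqP /= ->.
  by exists c => c'; rewrite eq_sym xpair_eqE eqxx andbT.
transitivity (\sum_c nuj R i z * m c z * Pr mu (fun b => prefix_eq b h i && (i < blen b)%N)).
  apply: eq_bigr => c _; rewrite -mH; apply: eq_bigl => b.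
  rewrite -!andbA; do 2 congr (_ && _).
  case: (b i) => [[c1|] o2] /=; rewrite xpair_eqE /= 1?andbC; last by [].
  by case: (o2 == _); rewrite ?andbF ?andbT.
by rewrite -mulr_suml -mulr_sumr (dm z).2 mulr1.
Qed.

Lemma sum_nuj i : \sum_z nuj R i z = 1.
Proof. by rewrite sum_bit2 /nuj /=; ring. Qed.

(** The masses of the genuine results of trial [i] are [nuj] times the mass of live blocks. As [nuj]
    sums to 1, they exhaust it and leave mass 0 for all other results. *)
Lemma in_C_alive b i : mu b != 0 -> (i < blen b)%N -> (b i).1 && (b i).2.
Proof.
move=> nz ib; apply: contraNT nz => nv; apply/eqP.
pose A (b : block k) := (i < blen b)%N.
apply: (@Pr_null _ _ _ mu0 (fun b => A b && ~~ ((b i).1 && (b i).2))); last by rewrite /A ib.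
have /eqP := PrID mu A (fun b => (b i).1 && (b i).2).
rewrite (@Pr_sum_unique _ _ _ bit2 (fun b => A b && ((b i).1 && (b i).2))
          (fun z b => (b i).2 == Some z)); last first.
  move=> b' _ /and3P[_ _]; case: (b' i).2 => // z _.
  by exists z => z'; rewrite eq_sym.
under eq_bigr => z _.
  rewrite (_ : Pr mu _ = nuj R i z * Pr mu A); last first.
    rewrite -Pr_alive_input; apply: eq_bigl => b'; rewrite -!andbA; congr [&& _, _ & _].
    by case: (b' i).2 => //= ?.
  over.
by rewrite -mulr_suml sum_nuj mul1r addrC -subr_eq subrr eq_sym => /eqP.
Qed.

Lemma in_C_dead b i : mu b != 0 -> (blen b <= i)%N -> b i = star.
Proof.
move=> nz bi; case: muC => _ [_ [_ [H _]]].
by apply: contraNeq nz => bs; apply/eqP/(Pr_null mu0 (H i)); rewrite bi.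
Qed.

Lemma in_C_wf b : mu b != 0 -> wf_block b.
Proof.
move=> nz; apply/forallP => i; case: (ltnP i (blen b)) => [/in_C_alive->//|]; first by rewrite orbT.
by move/(in_C_dead nz) => ->; rewrite eqxx.
Qed.

(** The stopping rates [qj] are those of a uniform length: each step multiplies the survival
    probability by [(2 ^ k - i - 1) / (2 ^ k - i)], and the product telescopes. *)
Lemma Pr_alive (i : nat) : (i <= 2 ^ k)%N ->
  Pr mu (fun b => (i < blen b)%N) = (2 ^ k - i)%N%:R / 2 ^+ k.
Proof.
case: muC => -[_ mu1] [H0 _].
elim: i => [_|i IH ik].
  have := PrID mu xpredT (fun b => blen b == 0%N); rewrite /= H0 add0r.
  rewrite {1}/Pr mu1 subn0 natrX mulfV ?expf_neq0 ?pnatr_eq0 // => ->.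
  by apply: eq_bigl => b; rewrite lt0n.
have := PrID mu (fun b => (i < blen b)%N) (fun b => blen b == i.+1).
rewrite IH ?(ltnW ik)//.
rewrite (_ : Pr mu (fun b => (i < blen b)%N && (blen b == i.+1)) =
  qj R (Ordinal ik) * ((2 ^ k - i)%N%:R / 2 ^+ k)); last first.
  rewrite -(IH (ltnW ik)) -[RHS](Pr_alive_last (Ordinal ik)).
  by apply: eq_bigl => b; case: eqP => [->|]; rewrite ?ltnS ?leqnn ?andbF.
rewrite (_ : Pr mu (fun b => (i < blen b)%N && (blen b != i.+1)) =
   Pr mu (fun b => (i.+1 < blen b)%N)); last first.
  by apply: eq_bigl => b; rewrite [RHS]ltn_neqAle andbC eq_sym.
rewrite /qj /=.
have e : (2 ^ k - i)%N%:R = (2 ^ k - i.+1)%N%:R + 1 :> R by rewrite natr1 -subSn.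
have n1 : (2 ^ k - i)%N%:R != 0 :> R by rewrite pnatr_eq0 -lt0n subn_gt0.
move/esym/(canRL (addKr _)) => ->.
have n2 : 2 ^+ k != 0 :> R by rewrite expf_neq0 ?pnatr_eq0.
rewrite mulrA mulVf // e; field; exact: n2.
Qed.

Lemma in_C_early b i : mu b != 0 -> (i.+1 < blen b)%N -> (b i).2 = Some (false, false).
Proof.
move=> nz bi; case: muC => _ [_ [_ [_ [_ H]]]].
apply: contraNeq nz => bs; apply/eqP/(Pr_null mu0 (H i)).
by rewrite (ltnW bi) bs /= gtn_eqF.
Qed.

(** An input other than 00 ends the block, so its mass at trial [i] is [qj / 4] times the survival
    probability. Input 00 may also occur without ending the block; its value is what the other three
    leave of the mass [(2 ^+ k)^-1] of this length. *)
Lemma Pr_last_input i z :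
  Pr mu (fun b => (blen b == i.+1) && ((b i).2 == Some z)) = (4 * 2 ^+ k)^-1.
Proof.
have n1 : (2 ^ k - i)%N%:R != 0 :> R by rewrite pnatr_eq0 -lt0n subn_gt0.
have n2 : 2 ^+ k != 0 :> R by rewrite expf_neq0 ?pnatr_eq0.
have nz w : w != (false, false) ->
  Pr mu (fun b => (blen b == i.+1) && ((b i).2 == Some w)) = (4 * 2 ^+ k)^-1.
  move=> wn; transitivity (nuj R i w * Pr mu (fun b => (i < blen b)%N)).
    rewrite -Pr_alive_input; apply: Pr_ae => b nz.
    case: (ltnP i (blen b)) => [ib|bi] /=; last by rewrite ltn_eqF ?ltnS.
    have /andP[-> _] /= := in_C_alive nz ib.
    case: ((b i).2 =P Some w) => [e|]; rewrite ?andbF //= andbT.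
    apply: contraNT wn => nb.
    have : (i.+1 < blen b)%N by rewrite ltn_neqAle eq_sym nb.
    by move/(in_C_early nz); rewrite e => -[->].
  rewrite Pr_alive ?(ltnW (ltn_ord i)) // /nuj (negPf wn) /qj.
  by field; rewrite n1 n2.
case: (eqVneq z (false, false)) => [->|/nz //].
have : Pr mu (fun b => blen b == i.+1) = (2 ^+ k)^-1.
  rewrite Pr_alive_last Pr_alive ?(ltnW (ltn_ord i)) // /qj.
  by field; rewrite n1 n2.
rewrite (@Pr_sum_unique _ _ _ bit2 _ (fun z b => (b i).2 == Some z)); last first.
  move=> b nzb /eqP eb; have ib : (i < blen b)%N by rewrite eb.
  have /andP[_] := in_C_alive nzb ib.
  by case: (b i).2 => // w _; exists w => w'; rewrite eq_sym.
rewrite sum_bit2 (nz (false, true)) // (nz (true, false)) // (nz (true, true)) // => /eqP; rewrite -!addrA -subr_eq0 => /eqP e.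
apply/eqP; rewrite -subr_eq0 -{}e; apply/eqP; by field.
Qed.

Lemma input_dist_marginal z :
  Pr mu (fun b => zseq b == z) = input_dist z.
Proof.
rewrite (@Pr_sum_unique _ _ _ ('I_(2 ^ k) * bit2)%type _
  (fun p b => (blen b == p.1.+1) && ((b p.1).2 == Some p.2))).
  apply: eq_bigr => -[i w] _ /=; rewrite -(Pr_last_input i w).
  (* On the support, the length [i.+1] and the last input [w] determine the whole input sequence. *)
  rewrite (@Pr_ae _ _ _ _ (fun b => (input_pattern i w == z) &&
    ((blen b == i.+1) && ((b i).2 == Some w)))); last first.
    move=> b nz; case: (blen b =P i.+1) => [eb|]; rewrite ?andbF //=.
    case: ((b i).2 =P Some w) => [ew|]; rewrite ?andbF //= !andbT; congr (_ == _).
    apply/ffunP => j; rewrite !ffunE.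
    case: (ltngtP j i) => [ji|ij|/val_inj ->].
    - by rewrite in_C_early // eb.
    - by rewrite in_C_dead ?eb // -val_eqE gtn_eqF.
    - by rewrite ew eqxx.
  by case: eqP => _; rewrite ?mul1r // mul0r /Pr big_pred0.
move=> b nz _; have b0 : (0 < blen b)%N.
  case: muC => _ [H _]; rewrite lt0n; apply: contraNN nz => b0.
  exact/eqP/(Pr_null mu0 H).
have bk : ((blen b).-1 < 2 ^ k)%N.
  by rewrite prednK // (leq_trans (max_card _)) ?card_ord.
have := in_C_alive (i := Ordinal bk) nz; rewrite /= prednK // leqnn => /(_ isT).
case ew : (b _).2 => [w|]; rewrite ?andbF // => _.
exists (Ordinal bk, w) => -[i w'] /=; rewrite xpair_eqE -val_eqE /=.
rewrite -[blen b]prednK // eqSS eq_sym; case: eqP => //= e.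
by rewrite (_ : i = Ordinal bk) ?ew 1?eq_sym //; apply: val_inj.
Qed.

End BlockInputs.

(** * Chains of blocks *)

Section Prefixes.
Variables (R : realType) (N : nat) (B : finType).
Implicit Types (v w h : {ffun 'I_N -> B}) (mu : {ffun 'I_N -> B} -> R).

(** The bound is a natural number, so that agreement on all [N] coordinates is included. *)
Definition agree n v h := [forall j : 'I_N, (j < n)%N ==> (v j == h j)].

Definition upd h (i : 'I_N) (b : B) : {ffun 'I_N -> B} :=
  [ffun j => if j == i then b else h j].

Definition prefix_mass mu n h := \sum_(v | agree n v h) mu v.

Lemma agreeP n v h : reflect (forall j : 'I_N, (j < n)%N -> v j = h j) (agree n v h).
Proof.
apply: (iffP forallP) => H j; first by move=> jn; apply/eqP; move: (H j); rewrite jn.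
by apply/implyP => /H ->.
Qed.

Lemma agree_refl n v : agree n v v. Proof. exact/agreeP. Qed.

Lemma agree_sym n v h : agree n v h = agree n h v.
Proof. by apply: eq_forallb => j; rewrite eq_sym. Qed.

Lemma agree_trans n u v w : agree n u v -> agree n v w -> agree n u w.
Proof. by move=> /agreeP a /agreeP b; apply/agreeP => j jn; rewrite a // b. Qed.

Lemma agree_le m n v h : (m <= n)%N -> agree n v h -> agree m v h.
Proof. by move=> mn /agreeP a; apply/agreeP => j jm; rewrite a ?(leq_trans jm). Qed.

Lemma agree0 v h : agree 0 v h. Proof. exact/agreeP. Qed.

Lemma agree_upd (i : 'I_N) v h b :
  agree i.+1 v (upd h i b) = agree i v h && (v i == b).
Proof.
apply/agreeP/andP => [a|[/agreeP a /eqP e] j].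
  split; last by rewrite a // ffunE eqxx.
  by apply/agreeP => j ji; rewrite a ?(leqW ji)// ffunE -val_eqE ltn_eqF.
rewrite ltnS leq_eqVlt ffunE => /orP[/eqP/val_inj ->|ji]; first by rewrite eqxx.
by rewrite -val_eqE ltn_eqF // a.
Qed.

Lemma upd_id v i : upd v i (v i) = v.
Proof. by apply/ffunP => j; rewrite ffunE; case: eqP => [->|]. Qed.

Lemma upd_agree (i : 'I_N) h b : agree i (upd h i b) h.
Proof. by apply/agreeP => j ji; rewrite ffunE -val_eqE ltn_eqF. Qed.

Lemma eq_prefix_mass mu n v h : agree n v h -> prefix_mass mu n v = prefix_mass mu n h.
Proof.
move=> a; apply: eq_bigl => w; apply/idP/idP => b; first exact: agree_trans b a.
by apply: agree_trans b _; rewrite agree_sym.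
Qed.

Lemma prefix_mass_split (F : {ffun 'I_N -> B} -> R) (i : 'I_N) h :
  \sum_(v | agree i v h) F v = \sum_b \sum_(v | agree i.+1 v (upd h i b)) F v.
Proof.
rewrite (partition_big (fun v => v i) predT) //=.
by apply: eq_bigr => b _; apply: eq_bigl => v; rewrite agree_upd.
Qed.

(* No sign condition on [mu]: applied to both [mu] and [- mu] it yields equalities. *)
Lemma prefix_chain_le mu (f : 'I_N -> {ffun 'I_N -> B} -> R) (c : 'I_N -> R) :
  (forall i v, 0 <= f i v) -> (forall i, 0 <= c i) ->
  (forall (i : 'I_N) v w, agree i.+1 v w -> f i v = f i w) ->
  (forall (i : 'I_N) h,
     \sum_b prefix_mass mu i.+1 (upd h i b) * f i (upd h i b) <= c i * prefix_mass mu i h) ->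
  forall n h, \sum_(v | agree n v h) mu v * \prod_(i : 'I_N | (n <= i)%N) f i v
              <= prefix_mass mu n h * \prod_(i : 'I_N | (n <= i)%N) c i.
Proof.
move=> f0 c0 fa fc n.
(* Downward induction on [n]: coordinate [n] is split off, its factor is constant on each longer
   prefix, the induction hypothesis bounds the later factors, and the one-step bound handles
   [f n]. *)
have [m] := ubnP (N - n)%N; elim: m n => // m IH n; rewrite ltnS => mn h.
have [Nn|nN] := leqP N n.
  rewrite /prefix_mass mulr_suml ler_sum // => v _.
  by rewrite !big_pred0 // => i; rewrite leqNgt (leq_trans (ltn_ord i)).
pose i0 := Ordinal nN.
have pS (g : 'I_N -> R) : \prod_(i : 'I_N | (n <= i)%N) g i =
    g i0 * \prod_(i : 'I_N | (n.+1 <= i)%N) g i.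
  rewrite (bigD1 i0) //=; congr (_ * _); apply: eq_bigl => i.
  by rewrite ltn_neqAle -val_eqE /= andbC eq_sym.
rewrite (prefix_mass_split _ i0) /=.
apply: (@le_trans _ _ (\sum_b f i0 (upd h i0 b) *
   (prefix_mass mu n.+1 (upd h i0 b) * \prod_(i : 'I_N | (n.+1 <= i)%N) c i))).
  apply: ler_sum => b _.
  under eq_bigr => v av.
    rewrite pS (fa i0 _ _ av) mulrCA; over.
  rewrite -mulr_sumr ler_wpM2l //; apply: IH.
  by apply: leq_trans mn; rewrite ltn_sub2l.
rewrite pS [X in _ <= X]mulrA [_ * c i0]mulrC.
under eq_bigr => b _ do rewrite mulrA [f _ _ * _]mulrC.
rewrite -mulr_suml ler_wpM2r ?prodr_ge0 //.
exact: (fc i0).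
Qed.
End Prefixes.

(** * Conditional block distributions and independence of later inputs *)

Section BlockChain.
Variables (R : realType) (Nb k : nat) (mu : vec Nb k -> R).
Hypothesis mu0 : forall v, 0 <= mu v.
Implicit Types (v w h : vec Nb k) (i : 'I_Nb).
Local Notation P := (prefix_mass mu).
Local Notation Zd := (@input_dist R k).

Definition next_block i h (b : block k) := P i.+1 (upd h i b) / P i h.

Hypothesis chainC : forall i h, P i h != 0 -> in_C (next_block i h).

Lemma prefix_mass_ge0 n h : 0 <= P n h. Proof. exact: sumr_ge0. Qed.

Lemma prefix_mass_gt0 n v : mu v != 0 -> 0 < P n v.
Proof.
move=> nz; rewrite /prefix_mass (bigD1 v) ?agree_refl //=.
by apply: ltr_pwDl; [rewrite lt0r nz mu0 | exact: sumr_ge0].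
Qed.

Lemma prefix_mass_upd i h b : P i (upd h i b) = P i h.
Proof. exact/eq_prefix_mass/upd_agree. Qed.

(** The chain rule also covers null histories: there [next_block] is a division by 0, and the longer
    prefix has mass 0 as well. *)
Lemma prefix_mass_next i h b : P i.+1 (upd h i b) = P i h * next_block i h b.
Proof.
rewrite /next_block; case: (eqVneq (P i h) 0) => [e|nz]; last by rewrite mulrC divfK.
rewrite e mul0r; apply: le_anti; rewrite prefix_mass_ge0 andbT -e.
rewrite /prefix_mass [leRHS](bigID (fun v => v i == b)) /=.
by under eq_bigl do rewrite agree_upd; rewrite lerDl sumr_ge0.
Qed.

Lemma chain_wf v i : mu v != 0 -> wf_block (v i).
Proof.
move=> nz; apply: (in_C_wf (chainC (lt0r_neq0 (prefix_mass_gt0 i nz)))).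
by rewrite /next_block upd_id mulf_neq0 ?invr_eq0 // lt0r_neq0 // prefix_mass_gt0.
Qed.

Lemma next_block_input i h z : P i h != 0 ->
  \sum_(b | zseq b == z) next_block i h b = Zd z.
Proof. by move=> /chainC/input_dist_marginal <-. Qed.

Lemma zvec_of_eq v w : (zvec_of v == zvec_of w) = [forall i : 'I_Nb, zseq (v i) == zseq (w i)].
Proof.
apply/eqP/forallP => [/ffunP e i|e]; first by have := e i; rewrite !ffunE => ->.
by apply/ffunP => i; rewrite !ffunE; apply/eqP.
Qed.

(* The past does not influence later inputs: the remaining factor depends on
   [zvec_of v] only. *)
Lemma free_choice n v :
  \sum_(w | agree n w v && (zvec_of w == zvec_of v)) mu w =
  P n v * \prod_(i : 'I_Nb | (n <= i)%N) Zd (zseq (v i)).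
Proof.
(* The product of these indicators over the blocks from [n] on selects the inputs of [v]. Each has
   conditional expectation [Zd (zseq (v i))] whatever the past. *)
pose f (i : 'I_Nb) (w : vec Nb k) : R := (zseq (w i) == zseq (v i))%:R.
have fa (i : 'I_Nb) (u w : vec Nb k) : agree i.+1 u w -> f i u = f i w by move=> /agreeP a; rewrite /f a.
have fc (i : 'I_Nb) (h : vec Nb k) : \sum_b P i.+1 (upd h i b) * f i (upd h i b) = Zd (zseq (v i)) * P i h.
  under eq_bigr => b _ do rewrite prefix_mass_next -mulrA.
  rewrite -mulr_sumr mulrC; case: (eqVneq (P i h) 0) => [->|nz]; first by rewrite !mulr0.
  congr (_ * _); rewrite -(next_block_input _ nz) [RHS]big_mkcond /=.
  by apply: eq_bigr => b _; rewrite /f ffunE eqxx; case: ifP; rewrite ?mulr1 ?mulr0.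
have E : \sum_(w | agree n w v && (zvec_of w == zvec_of v)) mu w =
         \sum_(w | agree n w v) mu w * \prod_(i : 'I_Nb | (n <= i)%N) f i w.
  rewrite big_mkcondr /=; apply: eq_bigr => w /agreeP a; rewrite zvec_of_eq.
  case: forallP => [H|H].
    by rewrite big1 ?mulr1 // => i _; rewrite /f H.
  have /forallPn[i ni] : ~~ [forall i : 'I_Nb, zseq (w i) == zseq (v i)] by apply/forallP.
  rewrite (bigD1 i) /=; last by rewrite leqNgt; apply: contra ni => /a ->.
  by rewrite /f (negPf ni) mul0r mulr0.
rewrite {}E; apply/eqP; rewrite eq_le; apply/andP; split.
  apply: prefix_chain_le => // [i|i h]; first exact: input_dist_ge0.
  by rewrite fc.
rewrite -lerN2 -mulNr -sumrN.
under [leLHS]eq_bigr => w _ do rewrite -mulNr.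
have PN m h : prefix_mass (fun w => - mu w) m h = - P m h by rewrite /prefix_mass sumrN.
rewrite -PN; apply: prefix_chain_le => // [i|i h]; first exact: input_dist_ge0.
by under eq_bigr => b _ do rewrite PN mulNr; rewrite PN sumrN fc mulrN.
Qed.

Lemma condCZ_next i h b : P i h != 0 ->
  condCZ (next_block i h) b = next_block i h b / Zd (zseq b).
Proof. by move=> nz; rewrite /condCZ next_block_input. Qed.

End BlockChain.

(** * The stopped protocol *)

Lemma flatten_map_inj (T : eqType) (U : Type) (f g : T -> seq U) (s : seq T) :
  {in s, forall x, size (f x) = size (g x)} ->
  flatten (map f s) = flatten (map g s) -> {in s, f =1 g}.
Proof.
move=> fg e; apply/eq_in_map; apply: eq_from_flatten_shape => //.
by rewrite /shape -!map_comp; apply/eq_in_map.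
Qed.

Lemma size_trial_bits t : size (trial_bits t) = 2%N.
Proof. by case: t => -[[]|]. Qed.

Lemma size_block_bits k (b : block k) : size (block_bits b) = (2 * 2 ^ k)%N.
Proof.
rewrite size_flatten /shape -map_comp sumnE big_map.
rewrite (eq_bigr (fun=> 2%N)) => [|j _]; last exact: size_trial_bits.
by rewrite big_enum /= sum_nat_const card_ord mulnC.
Qed.

(** The padded bits confuse a virtual trial with output 00. The inputs tell them apart, since in a
    well-formed block input and output are virtual together. *)
Lemma block_bits_inj k (b b' : block k) : wf_block b -> wf_block b' ->
  zseq b = zseq b' -> block_bits b = block_bits b' -> b = b'.
Proof.
move=> /forallP wb /forallP wb' /ffunP zz e; apply/ffunP => j.
have sz : {in enum 'I_(2 ^ k), forall i, size (trial_bits (b i)) = size (trial_bits (b' i))}.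
  by move=> i _; rewrite !size_trial_bits.
have := flatten_map_inj sz e; move=> /(_ j); rewrite mem_enum => /(_ isT).
move: (wb j) (wb' j) (zz j); rewrite !ffunE.
by case: (b j) (b' j) => [[[c1 c2]|] [z|]] [[[d1 d2]|] [z'|]] //= _ _ [->] [-> ->].
Qed.

Section StoppedProtocol.
Variables (R : realType) (Nb k : nat) (beta eps sigma eps_ext : R).
Variable (G : 'I_Nb -> seq (block k) -> block k -> R).
Hypotheses (eps0 : 0 < eps) (beta0 : 0 < beta) (eps_extP : eps_ext < eps).
Hypothesis Gpef : forall i h, block_PEF beta (G i h).
Local Notation stopped := (stopped_before beta eps sigma eps_ext G).
Local Notation accept := (accept beta eps sigma eps_ext G).
Local Notation cprime := (cprime beta eps sigma eps_ext G).
Local Notation tmin := (tmin beta eps sigma eps_ext).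
Local Notation tval := (Defs.tval G).
Local Notation q := (qpar eps sigma).
Local Notation eps_en := (eps_en eps eps_ext).

Implicit Types (v w h : vec Nb k) (i : 'I_Nb).

Lemma hist_agree i v w : agree i v w -> hist v i = hist w i.
Proof.
move=> /agreeP a; rewrite /hist; apply/eq_in_map => j.
by rewrite mem_filter => /andP[ji _]; exact: a.
Qed.

Lemma tval_agree i v w : agree i.+1 v w -> tval v i = tval w i.
Proof.
move=> a; apply: eq_bigr => j ji.
by rewrite (hist_agree (agree_le (leqW ji) a)) (agreeP _ _ _ a).
Qed.

Lemma stopped_agree i v w : agree i v w -> stopped v i = stopped w i.
Proof.
move=> a; apply: eq_existsb => j; case: (ltnP j i) => //= ji.
by rewrite (tval_agree (agree_le ji a)).
Qed.

(** Takes the first passing block. Minimality matters because [tval] may fall below [tmin] again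
    later. *)
Lemma accept_stop v : accept v ->
  exists2 s : 'I_Nb, tmin <= tval v s & forall j, stopped v j = (s < j)%N.
Proof.
move=> /existsP[i0 Hi0].
case: (arg_minnP (fun i : 'I_Nb => nat_of_ord i) (P := fun i => tmin <= tval v i) Hi0) => s Hs min.
exists s => // j; apply/existsP/idP => [[i /andP[ij /min]]|sj]; first by move/leq_ltn_trans; apply.
by exists s; rewrite sj.
Qed.

Definition segment v i :=
  if stopped v i then nseq (2 * 2 ^ k) false else block_bits (v i).

Lemma size_segment v i : size (segment v i) = (2 * 2 ^ k)%N.
Proof. by rewrite /segment; case: ifP; rewrite ?size_nseq ?size_block_bits. Qed.

Lemma cprime_segment v w : cprime v = cprime w -> segment v =1 segment w.
Proof.
move=> /ffunP e i.
have sz u : size (flatten [seq segment u j | j <- enum 'I_Nb]) = (Nb * 2 ^ k * 2)%N.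
  rewrite size_flatten /shape -map_comp sumnE big_map.
  rewrite (eq_bigr (fun=> (2 * 2 ^ k)%N)) => [|j _]; last exact: size_segment.
  by rewrite big_enum /= sum_nat_const card_ord mulnAC mulnA.
apply: (@flatten_map_inj _ _ _ _ (enum 'I_Nb)); last by rewrite mem_enum.
  by move=> j _; rewrite !size_segment.
apply: (@eq_from_nth _ false); first by rewrite !sz.
by move=> p; rewrite sz => pm; have := e (Ordinal pm); rewrite !ffunE.
Qed.

Lemma qpar_gt0 : 0 < q.
Proof. by rewrite mulr_gt0 // powR_gt0. Qed.

(** * Bounds for one value of the side information, with unnormalised mass *)

Section FixedSideInformation.
Variable mu : vec Nb k -> R.
Hypothesis mu0 : forall v, 0 <= mu v.
Hypothesis chainC : forall i h, prefix_mass mu i h != 0 -> in_C (next_block mu i h).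
Local Notation P := (prefix_mass mu).
Local Notation Zd := (@input_dist R k).

(* mu(c_i | z_i, past), by [condCZ_next] and [input_dist_marginal] *)
Definition cond_out i v := P i.+1 v / (P i v * Zd (zseq (v i))).
(* the product K of the header *)
Definition stopped_cond v := \prod_(i | ~~ stopped v i) cond_out i v.

Lemma cond_out_ge0 i v : 0 <= cond_out i v.
Proof. by rewrite mulr_ge0 ?invr_ge0 ?mulr_ge0 ?prefix_mass_ge0 ?input_dist_ge0. Qed.

Lemma stopped_cond_ge0 v : 0 <= stopped_cond v.
Proof. by apply: prodr_ge0 => i _; exact: cond_out_ge0. Qed.

(** Factor of the stopped product. The value 1 after the stop freezes the product, which turns it
    into a supermartingale over all [Nb] blocks. *)
Definition gain i v :=
  if stopped v i then 1 else G i (hist v i) (v i) * cond_out i v `^ beta.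

Lemma gain_ge0 i v : 0 <= gain i v.
Proof.
by rewrite /gain; case: ifP => // _; rewrite mulr_ge0 ?powR_ge0 //; case: (Gpef i (hist v i)).
Qed.

(** Stopping before block [i] is decided by the past. So, given the past, the factor is either
    constantly 1 or has expectation at most 1 by the PEF inequality for [next_block], whose [condCZ]
    is [cond_out]. *)
Lemma sum_gain_le : \sum_v mu v * \prod_i gain i v <= \sum_v mu v.
Proof.
case: (pickP (xpredT : pred (vec Nb k))) => [h0 _|no]; last first.
  by rewrite !big1 // => v; have := no v.
have loc (i : 'I_Nb) (v w : vec Nb k) : agree i.+1 v w -> gain i v = gain i w.
  move=> a; rewrite /gain /cond_out (eq_prefix_mass _ a) (eq_prefix_mass _ (agree_le (leqnSn i) a)).
  by rewrite (stopped_agree (agree_le (leqnSn i) a)) (hist_agree (agree_le (leqnSn i) a))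
    (agreeP _ _ _ a).
have step (i : 'I_Nb) (h : vec Nb k) :
  \sum_b P i.+1 (upd h i b) * gain i (upd h i b) <= 1 * P i h.
  rewrite mul1r; under eq_bigr => b _ do rewrite (prefix_mass_next mu0) -mulrA.
  rewrite -mulr_sumr; case: (eqVneq (P i h) 0) => [->|nz]; first by rewrite mul0r.
  rewrite -[leRHS]mulr1 ler_wpM2l ?prefix_mass_ge0 //.
  have [C1 _] := chainC nz.
  have [st|st] := boolP (stopped h i).
    rewrite -C1.2 ler_sum // => b _.
    by rewrite /gain (stopped_agree (upd_agree i h b)) st mulr1.
  apply: le_trans ((Gpef i (hist h i)).2 _ (chainC nz)).
  rewrite ler_sum // => b _; rewrite /gain (stopped_agree (upd_agree i h b)) (negPf st).
  rewrite (hist_agree (upd_agree i h b)) ffunE eqxx condCZ_next // -mulrA.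
  rewrite (_ : cond_out _ _ = next_block mu i h b / Zd (zseq b)) //.
  by rewrite /cond_out prefix_mass_upd ffunE eqxx invfM mulrA.
have := prefix_chain_le gain_ge0 (fun=> ler01) loc step 0 h0.
rewrite big1_eq mulr1 /prefix_mass (eq_bigl xpredT) => [|v]; last exact: agree0.
rewrite [X in _ <= X](eq_bigl xpredT) => [|v]; last exact: agree0.
by [].
Qed.

Lemma prod_gain v (s : 'I_Nb) : (forall j, stopped v j = (s < j)%N) ->
  \prod_i gain i v = tval v s * stopped_cond v `^ beta.
Proof.
move=> st; rewrite (bigID (fun i => ~~ stopped v i)) /= [X in _ * X]big1 ?mulr1; last first.
  by move=> i; rewrite /gain negbK => ->.
have -> : stopped_cond v `^ beta = \prod_(i | ~~ stopped v i) cond_out i v `^ beta.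
  (* Real powers are multiplicative on non-negative numbers, so non-negativity is carried through
     the induction. *)
  rewrite /stopped_cond; suff [] : 0 <= \prod_(i | ~~ stopped v i) cond_out i v /\
    (\prod_(i | ~~ stopped v i) cond_out i v) `^ beta =
     \prod_(i | ~~ stopped v i) cond_out i v `^ beta by [].
  elim/big_ind2 : _ => [|x y x' y' [x0 <-] [y0 <-]|i _]; first by rewrite powR1.
    by rewrite mulr_ge0 // powRM.
  by rewrite cond_out_ge0.
have -> : tval v s = \prod_(i | ~~ stopped v i) G i (hist v i) (v i).
  by apply: eq_bigl => i; rewrite st -leqNgt.
by rewrite -big_split /=; apply: eq_bigr => i /negPf ns; rewrite /gain ns.
Qed.

(** Markov's inequality: on this event the stopped product is at least [tmin * q ^ beta], which
    equals [eps_en^-1] by the choice of [tmin]. *)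
Lemma bad_mass_le :
  \sum_(v | accept v && (q <= stopped_cond v)) mu v <= eps_en * \sum_v mu v.
Proof.
have en0 : 0 < eps_en by rewrite subr_gt0.
rewrite -ler_pdivrMl //; apply: le_trans sum_gain_le.
rewrite mulr_sumr big_mkcond ler_sum //= => v _; rewrite mulrC.
case: ifP => [/andP[/accept_stop[s ts st] qs]|_]; last first.
  by rewrite mulr_ge0 // prodr_ge0 // => i _; exact: gain_ge0.
rewrite ler_wpM2l // (prod_gain st).
have qb : 0 < q `^ beta by rewrite powR_gt0 // qpar_gt0.
apply: (@le_trans _ _ (tmin * q `^ beta)).
  by rewrite /Defs.tmin invfM mulrAC mulVf ?mul1r ?lt0r_neq0.
have t0 : 0 <= tmin by rewrite invr_ge0 mulr_ge0 // ltW.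
apply: ler_pM => //; first exact: ltW.
apply: ge0_ler_powR; rewrite ?nnegrE ?stopped_cond_ge0 //; apply: ltW => //.
exact: qpar_gt0.
Qed.

Lemma input_dist_neq0 v i : mu v != 0 -> Zd (zseq (v i)) != 0.
Proof.
move=> nz; have Pi := lt0r_neq0 (prefix_mass_gt0 mu0 i nz).
rewrite -(next_block_input chainC _ Pi) lt0r_neq0 // (bigD1 (v i)) //=.
apply: ltr_pwDl.
  by rewrite /next_block upd_id divr_gt0 ?prefix_mass_gt0.
by apply: sumr_ge0 => b _; rewrite /next_block divr_ge0 ?prefix_mass_ge0.
Qed.

(** Each denominator [P i v] cancels the preceding numerator. The factor [P 0 v] remains because
    [mu] is the part of the joint distribution at one value of [E] and has total mass other than 1
    in general. *)
Lemma cond_out_telescope v n : mu v != 0 -> (n <= Nb)%N ->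
  (\prod_(i : 'I_Nb | (i < n)%N) cond_out i v) *
  (P 0 v * \prod_(i : 'I_Nb | (i < n)%N) Zd (zseq (v i))) = P n v.
Proof.
move=> nz; elim: n => [_|n IH nN].
  by rewrite !big_pred0 // mul1r mulr1.
pose i0 := Ordinal nN.
have pS (g : 'I_Nb -> R) : \prod_(i : 'I_Nb | (i < n.+1)%N) g i =
    g i0 * \prod_(i : 'I_Nb | (i < n)%N) g i.
  rewrite (bigD1 i0) //=; congr (_ * _); apply: eq_bigl => i.
  by rewrite ltnS [RHS]ltn_neqAle -val_eqE /= andbC.
rewrite !pS -[RHS](divfK (lt0r_neq0 (prefix_mass_gt0 mu0 n nz))) -{2}(IH (ltnW nN)).
rewrite /cond_out; have Zn := input_dist_neq0 i0 nz.
have Pn := lt0r_neq0 (prefix_mass_gt0 mu0 n nz).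
move: (\prod_(_ | _) _) (\prod_(_ | _) _) => A B.
by rewrite /=; field; rewrite Pn.
Qed.

(** Identifies [stopped_cond v] as the conditional probability of the blocks up to the stop given
    all inputs. Apply [free_choice] at [s.+1] and at 0: the input factors after [s] are common to
    both sides, and the earlier ones telescope. *)
Lemma prefix_mass_stopped v (s : 'I_Nb) : mu v != 0 -> (forall j, stopped v j = (s < j)%N) ->
  \sum_(w | agree s.+1 w v && (zvec_of w == zvec_of v)) mu w =
  stopped_cond v * \sum_(w | zvec_of w == zvec_of v) mu w.
Proof.
move=> nz st; rewrite (free_choice mu0 chainC).
rewrite [X in _ = _ * X](eq_bigl (fun w => agree 0 w v && (zvec_of w == zvec_of v))); last first.
  by move=> w; rewrite agree0.
rewrite (free_choice mu0 chainC) -(cond_out_telescope nz (ltn_ord s)).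
rewrite [X in _ = _ * (_ * X)](bigID (fun i : 'I_Nb => (i < s.+1)%N)) /=.
have -> : stopped_cond v = \prod_(i : 'I_Nb | (i < s.+1)%N) cond_out i v.
  by apply: eq_bigl => i; rewrite st -leqNgt.
rewrite -!mulrA; congr (_ * (_ * (_ * _))); apply: eq_bigl => i.
by rewrite -leqNgt.
Qed.

(** Decoding proceeds block by block. Agreement on the earlier blocks shows that [w] has not stopped
    before block [n] either, so its segment holds genuine outputs, which the inputs make
    decodable. *)
Lemma cprime_agree v w (s : 'I_Nb) : mu v != 0 -> mu w != 0 ->
  (forall j, stopped v j = (s < j)%N) ->
  cprime w = cprime v -> zvec_of w = zvec_of v -> agree s.+1 w v.
Proof.
move=> nv nw st /cprime_segment cw /ffunP zw.
suff : forall n, (n <= s.+1)%N -> agree n w v by apply.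
elim=> [_|n IH ns]; first exact: agree0.
have nN : (n < Nb)%N by rewrite (leq_trans ns).
pose i := Ordinal nN; have a : agree i w v := IH (ltnW ns).
suff e : w i = v i by have := agree_upd i w v (v i); rewrite upd_id a e eqxx.
have := cw i; rewrite /segment (stopped_agree a) st ltnNge -ltnS ns /=.
apply: block_bits_inj; [exact: (chain_wf mu0 chainC)..|].
by have := zw i; rewrite !ffunE.
Qed.

(** If some [v] of positive mass contributes, every other contributor agrees with it up to its stop,
    so the mass is at most [stopped_cond v < q] times that of the inputs. *)
Lemma good_mass_le c zv :
  \sum_(w | [&& accept w, stopped_cond w < q, cprime w == c & zvec_of w == zv]) mu w
  <= q * \sum_(w | zvec_of w == zv) mu w.
Proof.
pose A w := [&& accept w, stopped_cond w < q, cprime w == c & zvec_of w == zv].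
have [v /andP[/and4P[av gv /eqP cv /eqP zE] nv]|no] := pickP (fun w => A w && (mu w != 0)).
  have [s ts st] := accept_stop av.
  apply: (@le_trans _ _ (\sum_(w | agree s.+1 w v && (zvec_of w == zvec_of v)) mu w)).
    rewrite big_mkcond [leRHS]big_mkcond ler_sum //= => w _.
    case: ifP => [/and4P[_ _ /eqP cw /eqP zw]|_]; last by case: ifP.
    case: (eqVneq (mu w) 0) => [->|nw]; first by case: ifP.
    by rewrite (cprime_agree nv nw st) ?cw ?cv ?zw ?zE // eqxx.
  rewrite (prefix_mass_stopped nv st) zE.
  by apply: ler_wpM2r; [exact: sumr_ge0 | exact: ltW].
rewrite big1 => [|w Aw]; first by rewrite mulr_ge0 ?sumr_ge0 // ltW // qpar_gt0.
by have := no w; rewrite /A Aw /= => /negbFE/eqP.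
Qed.

End FixedSideInformation.
End StoppedProtocol.

(** * Smoothing and the extractor *)

Section MinEntropy.
Variable R : realType.

Lemma sum_pair (A B : finType) (F : A * B -> R) :
  \sum_x F x = \sum_b \sum_a F (a, b).
Proof. by rewrite exchange_big pair_bigA; apply: eq_bigr => -[]. Qed.

Lemma card_bits n : #|{: bits n}| = (2 ^ n)%N.
Proof. by rewrite card_ffun card_bool card_ord. Qed.

(** Each term of the guessing probability equals [max_c mu (c, e)], which [B e] dominates. *)
Lemma Hmin_ge (C E : finType) (mu : C * E -> R) (B : E -> R) (sigma : R) :
  is_dist mu -> (forall c e, mu (c, e) <= B e) -> (forall e, 0 <= B e) ->
  \sum_e B e <= 2 `^ (- sigma) -> sigma <= Hmin mu.
Proof.
move=> [mu0 mu1] muB B0 SB; rewrite /Hmin lerNr /log2.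
set g := \sum_e _.
have ln2 : 0 < ln (2 : R) by rewrite ln_gt0 // ltr1n.
have cond0 c e : 0 <= condP mu c e by rewrite divr_ge0 // sumr_ge0.
have max0 e : 0 <= \big[Num.max/0]_c condP mu c e by exact: bigmax_ge_id.
have S0 e : 0 <= \sum_c mu (c, e) by exact: sumr_ge0.
have gB : g <= 2 `^ (- sigma).
  apply: le_trans SB; apply: ler_sum => e _; set S := \sum_c _.
  case: (eqVneq S 0) => [->|nz]; first by rewrite mul0r.
  rewrite mulrC -ler_pdivlMr; last by rewrite lt0r nz S0.
  apply: bigmax_le => [|c _]; first by rewrite divr_ge0 ?S0.
  by rewrite ler_wpM2r ?invr_ge0 ?S0.
(* Comparing logarithms needs a positive guessing probability; were it 0, all of [mu] would
   vanish. *)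
have g0 : 0 < g.
  rewrite lt0r sumr_ge0 ?andbT => [|e _]; last by rewrite mulr_ge0.
  apply/negP => /eqP ge0.
  have gz e : (\sum_c mu (c, e)) * \big[Num.max/0]_c condP mu c e = 0.
    by apply: (psumr_eq0P _ ge0) => // e' _; rewrite mulr_ge0.
  move: mu1; rewrite sum_pair big1 => [/eqP|e _]; first by rewrite eq_sym oner_eq0.
  have /eqP := gz e; rewrite mulf_eq0 => /orP[/eqP //|/eqP m0].
  apply: big1 => c _; apply/eqP; have := le_bigmax 0 (condP mu ^~ e) c.
  rewrite m0 /condP => h; have /eqP : mu (c, e) / \sum_c' mu (c', e) = 0.
    by apply: le_anti; rewrite h cond0.
  rewrite mulf_eq0 invr_eq0 => /orP[//|/eqP /psumr_eq0P z].
  by rewrite z.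
rewrite ler_pdivrMr // -ln_powR ler_ln ?posrE //.
by rewrite powR_gt0.
Qed.

(** For each [y], move [Jg] towards the constant cap [q * M y] by the fraction [l y] that restores
    the marginal of [J]. The cap has total mass at least [M y] because [#|C| * q >= 1], so the
    fraction is at most 1. *)
Lemma refill (C Y : finType) (J Jg : C * Y -> R) (M : Y -> R) (q : R) :
  (forall x, Jg x <= J x) -> (forall c y, Jg (c, y) <= q * M y) ->
  (forall y, 0 <= M y) -> (forall y, \sum_c J (c, y) <= M y) -> 1 <= #|C|%:R * q ->
  exists g : C * Y -> R,
    [/\ forall x, Jg x <= g x, forall c y, g (c, y) <= q * M y &
        forall y, \sum_c g (c, y) = \sum_c J (c, y)].
Proof.
move=> JgJ Jgq M0 JM q1.
pose S y := \sum_c Jg (c, y); pose T y := \sum_c J (c, y).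
pose K y := \sum_(c : C) q * M y.
have ST y : S y <= T y by exact: ler_sum.
have TK y : T y <= K y.
  by rewrite (le_trans (JM y)) // /K sumr_const -mulr_natl mulrA ler_peMl.
(* If [K y = S y] then [T y = S y] too, and the junk value [l y = 0] is right. *)
pose l y := (T y - S y) / (K y - S y).
have l0 y : 0 <= l y by rewrite divr_ge0 ?subr_ge0 // (le_trans (ST y)).
have l1 y : l y <= 1.
  rewrite /l; case: (eqVneq (K y - S y) 0) => [->|nz]; first by rewrite invr0 mulr0.
  rewrite ler_pdivrMr ?mul1r ?lerD2r //.
  by rewrite lt0r nz subr_ge0 (le_trans (ST y)).
exists (fun x => Jg x + l x.2 * (q * M x.2 - Jg x)); split => [[c y]|c y|y] /=.
- by rewrite lerDl mulr_ge0 ?subr_ge0.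
- by rewrite addrC -lerBrDr ler_piMl ?subr_ge0.
rewrite big_split /= -mulr_sumr sumrB -/(S y) -/(K y) -/(T y) /l.
case: (eqVneq (K y - S y) 0) => [e|nz]; last by rewrite divfK // addrC subrK.
rewrite e mulr0 addr0; apply: le_anti; rewrite ST /=.
by rewrite (le_trans (TK y)) // -subr_le0 e.
Qed.

Lemma sum_ext_indicator ds kout (Ext : bits ds -> bits kout) :
  \sum_(x : bits kout * bits ds) ((2 : R) ^+ ds)^-1 * (Ext x.2 == x.1)%:R = 1.
Proof.
rewrite sum_pair (eq_bigr (fun=> ((2 : R) ^+ ds)^-1)) => [|s _] /=.
  rewrite sumr_const card_bits -[LHS]mulr_natl natrX mulfV //.
  by rewrite expf_neq0 // pnatr_eq0.
rewrite -mulr_sumr (bigD1 (Ext s)) //= eqxx big1 ?addr0 ?mulr1 // => r.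
by rewrite eq_sym => /negPf ->.
Qed.

Lemma sum_uniform n m : \sum_(x : bits n * bits m) ((2 : R) ^+ (n + m))^-1 = 1.
Proof.
rewrite sumr_const card_prod !card_bits -expnD -[LHS]mulr_natl natrX mulfV //.
by rewrite expf_neq0 // pnatr_eq0.
Qed.

(** * The extractor applied to subnormalised distributions *)

Section StrongExtractor.
Variables (m ds kout : nat) (Ext : bits m -> bits ds -> bits kout) (sigma eps_ext : R).
Hypothesis ext : strong_extractor Ext sigma eps_ext.
Variables (Y : finType).
Implicit Types (J g : bits m * Y -> R).

Definition extracted J (x : (bits kout * bits ds) * Y) : R :=
  \sum_c J (c, x.2) * ((2 : R) ^+ ds)^-1 * (Ext c x.1.2 == x.1.1)%:R.

Definition ideal J (x : (bits kout * bits ds) * Y) : R :=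
  ((2 : R) ^+ (kout + ds))^-1 * \sum_c J (c, x.2).

Lemma sum_extracted J : \sum_x extracted J x = \sum_x J x.
Proof.
rewrite sum_pair [RHS]sum_pair; apply: eq_bigr => y _.
rewrite exchange_big /=; apply: eq_bigr => c _.
under eq_bigr => x _ do rewrite -mulrA.
by rewrite -mulr_sumr sum_ext_indicator mulr1.
Qed.

Lemma sum_ideal J : \sum_x ideal J x = \sum_x J x.
Proof.
rewrite sum_pair [RHS]sum_pair; apply: eq_bigr => y _.
by rewrite /ideal /= -mulr_suml sum_uniform mul1r.
Qed.

(** Data processing: extraction is linear with a stochastic kernel, hence contracts the L1
    distance. *)
Lemma dist_extracted_le J g :
  \sum_x `|extracted J x - extracted g x| <= \sum_x `|J x - g x|.
Proof.
rewrite -(sum_extracted (fun x => `|J x - g x|)) ler_sum // => x _.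
rewrite /extracted -sumrB (le_trans (ler_norm_sum _ _ _)) // ler_sum // => c _.
rewrite -!mulrBl !normrM !(ger0_norm (x := _^-1)) ?invr_ge0 ?exprn_ge0 //.
by rewrite normr_nat.
Qed.

(** Replace [J] by its refilled version [g], to which the extractor applies after division by [p].
    The ideal side does not change, as it depends only on the marginal on [Y], which [g] shares with
    [J]. *)
Lemma extracted_ideal_le J Jg (M : Y -> R) (eps : R) :
  (forall x, 0 <= Jg x) -> (forall x, Jg x <= J x) ->
  (forall c y, Jg (c, y) <= 2 `^ (- sigma) * eps * M y) ->
  (forall y, 0 <= M y) -> \sum_y M y = 1 -> (forall y, \sum_c J (c, y) <= M y) ->
  1 <= #|{: bits m}|%:R * (2 `^ (- sigma) * eps) ->
  0 < eps -> eps <= \sum_x J x ->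
  2^-1 * \sum_x `|extracted J x - ideal J x| <= \sum_x (J x - Jg x) + eps_ext.
Proof.
move=> Jg0 JgJ JgM M0 M1 JM cap eps0; set p := \sum_x J x => epsp.
have [g [Jgg gq gJ]] := refill JgJ JgM M0 JM cap.
have p0 : 0 < p by exact: lt_le_trans epsp.
have p1 : p <= 1 by rewrite -M1 /p sum_pair ler_sum.
have sgJ : \sum_x g x = \sum_x J x by rewrite sum_pair [RHS]sum_pair; exact: eq_bigr.
pose g' (x : bits m * Y) := p^-1 * g x.
have g'd : is_dist g'.
  split=> [x|]; first by rewrite mulr_ge0 ?invr_ge0 ?(ltW p0) // (le_trans (Jg0 x)).
  by rewrite -mulr_sumr sgJ mulVf ?lt0r_neq0.
have hm : sigma <= Hmin g'.
  (* The factor [eps] in [q] pays for the normalisation: [eps / p <= 1]. *)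
  apply: (@Hmin_ge _ _ _ (fun y => 2 `^ (- sigma) * (eps / p) * M y)) => //.
  - move=> c y; rewrite /g' mulrC ler_pdivrMr // (le_trans (gq c y)) //.
    by rewrite le_eqVlt; apply/orP; left; apply/eqP; field; rewrite lt0r_neq0.
  - by move=> y; rewrite mulr_ge0 // mulr_ge0 ?powR_ge0 // divr_ge0 // ltW.
  - by rewrite -mulr_sumr M1 mulr1 ler_piMr ?powR_ge0 // ler_pdivrMr // mul1r.
have := ext g'd hm; rewrite /TV.
have pe x : p * extracted g' x = extracted g x.
  rewrite /extracted mulr_sumr; apply: eq_bigr => c _.
  by rewrite /g' !mulrA mulfV ?mul1r // lt0r_neq0.
have pi x : p * ideal g' x = ideal J x.
  by rewrite /ideal -gJ /g' -mulr_sumr mulrCA mulVKf // lt0r_neq0.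
move=> te; have half0 : 0 <= 2^-1 :> R by rewrite invr_ge0 ler0n.
set D := \sum_x (J x - Jg x).
apply: (@le_trans _ _ (2^-1 * (\sum_x `|extracted J x - extracted g x| +
   p * \sum_x `|extracted g' x - ideal g' x|))).
  rewrite ler_wpM2l // mulr_sumr -big_split ler_sum //= => x _.
  rewrite -{1}(gtr0_norm p0) -normrM mulrBr pe pi.
  by rewrite -[X in `|X|](subrKA (extracted g x)) ler_normD.
(* The extractor error enters with weight [p <= 1]. *)
rewrite mulrDr lerD //; last first.
  by rewrite mulrCA (le_trans _ te) // ler_piMl // mulr_ge0 // sumr_ge0.
(* Both [J] and [g] dominate [Jg] and exceed it by the same total mass [D], so their L1 distance is
   at most [D + D]. *)
apply: (@le_trans _ _ (2^-1 * (D + D))); last first.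
  by rewrite (_ : 2^-1 * (D + D) = D) //; field.
rewrite ler_wpM2l // (le_trans (dist_extracted_le _ _)) //.
have DE : D = \sum_x (g x - Jg x) by rewrite /D !sumrB sgJ.
rewrite {2}DE /D -big_split ler_sum //= => x _.
rewrite -[J x - g x](subrKA (Jg x)) (le_trans (ler_normD _ _)) //.
by rewrite [`|Jg x - _|]distrC !ger0_norm ?subr_ge0.
Qed.
End StrongExtractor.
End MinEntropy.

(** * Soundness *)

Lemma sum_fibers_fun (R : realType) (C T : finType) (f : T -> C) (A : pred T) (F : T -> R)
    (g : C -> R) :
  \sum_c (\sum_(x | A x && (f x == c)) F x) * g c = \sum_(x | A x) F x * g (f x).
Proof.
rewrite [RHS](partition_big f predT) //=; apply: eq_bigr => c _.
by rewrite mulr_suml; apply: eq_bigr => x /andP[_ /eqP ->].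
Qed.

(** As [log2 eps <= 0] and [(1 + beta) / beta >= 1], the bound on [sigma] implies
    [sigma <= m + log2 eps], which is the claim in logarithmic form. *)
Lemma room_le (R : realType) (m : nat) (beta eps sigma : R) :
  0 < beta -> 0 < eps <= 1 -> sigma <= m%:R + (1 + beta) / beta * log2 eps ->
  1 <= (2 ^ m)%N%:R * (2 `^ (- sigma) * eps).
Proof.
move=> b0 /andP[e0 e1] sm.
have l2 : 0 < ln (2 : R) by rewrite ln_gt0 // ltr1n.
have le : ln eps <= 0 by rewrite ln_le0.
have p2 : 0 < 2 `^ (- sigma) by rewrite powR_gt0.
have m2 : 0 < (2 ^ m)%N%:R :> R by rewrite ltr0n expn_gt0.
rewrite -ler_ln ?posrE ?mulr_gt0 // ln1 !lnM ?posrE ?mulr_gt0 // natrX lnXn // ln_powR.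
have : (1 + beta) / beta * log2 eps <= log2 eps.
  rewrite ler_neMl ?ler_pdivlMr ?mul1r ?lerDr //.
  by rewrite /log2 pmulr_lle0 ?invr_gt0.
rewrite /log2 => h; have := le_trans sm (lerD (lexx _) h).
rewrite -subr_ge0 -(pmulr_lge0 _ l2) mulrBl mulrDl divfK ?lt0r_neq0 // -[ln 2 *+ m]mulr_natl.
by move=> ?; lra.
Qed.

Section Soundness.
Variables (R : realType) (k kout : nat) (eps : R) (Nb : nat) (beta : R).
Variables (G : 'I_Nb -> seq (block k) -> block k -> R).
Variables (ds : nat) (Ext : bits (Nb * 2 ^ k * 2) -> bits ds -> bits kout).
Variables (sigma eps_ext : R) (E : finType) (mu : vec Nb k * E -> R).
Hypotheses (eps0 : 0 < eps) (beta0 : 0 < beta) (eps_extP : eps_ext < eps).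
Hypothesis Gpef : forall i h, block_PEF beta (G i h).
Hypothesis muH : in_H mu.
Local Notation accept := (accept beta eps sigma eps_ext G).
Local Notation cprime := (cprime beta eps sigma eps_ext G).
Local Notation q := (qpar eps sigma).
Local Notation zvE := (zvec Nb k * E)%type.
Local Notation m := (Nb * 2 ^ k * 2)%N.

Lemma in_H_ge0 x : 0 <= mu x. Proof. by case: muH => -[]. Qed.

Lemma in_H_next e (i : 'I_Nb) (h : vec Nb k) : prefix_mass (fun v => mu (v, e)) i h != 0 ->
  in_C (next_block (fun v => mu (v, e)) i h).
Proof.
have PE (A : pred (vec Nb k)) : Pr mu (fun x => (x.2 == e) && A x.1) = \sum_(v | A v) mu (v, e).
  rewrite /Pr big_mkcond sum_pair (bigD1 e) //= eqxx -big_mkcond [X in _ + X]big1 ?addr0 //.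
  by move=> e' /negPf ne; rewrite big1 // => v _; rewrite /= ne.
case: muH => _ H nz; have [|rho [rhoC rhoE]] := H e i h.
  by rewrite (PE (fun v => vprefix_eq v h i)).
suff -> : next_block (fun v => mu (v, e)) i h = rho by [].
apply: funext => b; rewrite /next_block.
transitivity (Pr mu (fun x => (x.2 == e) && (vprefix_eq x.1 h i && (x.1 i == b))) /
              prefix_mass (fun v => mu (v, e)) i h).
  by rewrite (PE (fun v => vprefix_eq v h i && (v i == b))) /prefix_mass; under eq_bigl do rewrite agree_upd.
by rewrite rhoE (PE (fun v => vprefix_eq v h i)) mulrC mulKf.
Qed.

Definition good e v := stopped_cond beta eps sigma eps_ext G (fun v => mu (v, e)) v < q.
Definition pass_joint (x : bits m * zvE) : R :=
  \sum_(v | (accept v && (zvec_of v == x.2.1)) && (cprime v == x.1)) mu (v, x.2.2).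
Definition good_joint (x : bits m * zvE) : R :=
  \sum_(v | (accept v && (zvec_of v == x.2.1) && good x.2.2 v) && (cprime v == x.1))
     mu (v, x.2.2).
Definition input_joint (y : zvE) : R := \sum_(v | zvec_of v == y.1) mu (v, y.2).

Lemma sum_good_joint :
  \sum_x good_joint x = \sum_e \sum_(v | accept v && good e v) mu (v, e).
Proof.
rewrite sum_pair sum_pair; apply: eq_bigr => e _.
rewrite (partition_big (@zvec_of Nb k) predT) //=; apply: eq_bigr => zv _.
rewrite [RHS](partition_big cprime predT) //=; apply: eq_bigr => c _.
by apply: eq_bigl => v; rewrite (andbAC (accept v)).
Qed.

Lemma pass_joint_marginal y :
  \sum_c pass_joint (c, y) = \sum_(v | accept v && (zvec_of v == y.1)) mu (v, y.2).
Proof. by rewrite [RHS](partition_big cprime predT). Qed.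

Lemma sum_pass_joint : \sum_x pass_joint x = \sum_e \sum_(v | accept v) mu (v, e).
Proof.
rewrite sum_pair sum_pair; apply: eq_bigr => e _.
rewrite [RHS](partition_big (@zvec_of Nb k) predT) //=; apply: eq_bigr => zv _.
exact: pass_joint_marginal.
Qed.

Lemma good_le_pass x : good_joint x <= pass_joint x.
Proof.
rewrite /good_joint big_mkcond /pass_joint [leRHS]big_mkcond ler_sum // => v _.
case: (accept v && _) => //=; case: (cprime v == _); rewrite ?andbF // andbT.
by case: ifP => // _; exact: in_H_ge0.
Qed.

Lemma good_joint_le c y : good_joint (c, y) <= q * input_joint y.
Proof.
case: y => zv e; rewrite /good_joint /input_joint /=.
have := good_mass_le beta sigma eps_ext G eps0 (fun v => in_H_ge0 (v, e)) (@in_H_next e) c zv.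
apply: le_trans; rewrite le_eqVlt; apply/orP; left; apply/eqP.
by apply: eq_bigl => v; rewrite -!andbA; congr (_ && _); rewrite [RHS]andbA andbC.
Qed.

(** The removed mass is that of passing runs with large [stopped_cond]; sum the Markov bound over
    [e], the weights adding up to 1. *)
Lemma bad_joint_le : \sum_x (pass_joint x - good_joint x) <= eps - eps_ext.
Proof.
rewrite sumrB sum_pass_joint sum_good_joint -sumrB.
case: muH => -[_ mu1] _.
rewrite -[leRHS]mulr1 -mu1 sum_pair mulr_sumr ler_sum // => e _.
have := bad_mass_le sigma eps0 beta0 eps_extP Gpef (fun v => in_H_ge0 (v, e)) (@in_H_next e).
apply: le_trans; rewrite [X in X - _](bigID (good e)) /= addrAC subrr add0r le_eqVlt; apply/orP; left; apply/eqP.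
by apply: eq_bigl => v; rewrite /good -leNgt.
Qed.

Lemma pi_mu_pass r s zv e :
  pi_mu beta eps sigma eps_ext G Ext mu true r s zv e =
  extracted Ext pass_joint ((r, s), (zv, e)).
Proof.
rewrite /extracted /pi_mu sum_pair (bigD1 e) //= [X in _ + X]big1 ?addr0; last first.
  move=> e' /negPf ne; rewrite big1 // => v _; rewrite big1 // => s' _.
  by rewrite /= ne andbF mulr0.
under [RHS]eq_bigr => c _ do rewrite -mulrA.
rewrite (sum_fibers_fun cprime (fun v => accept v && (zvec_of v == zv)) (fun v => mu (v, e))
  (fun c => ((2 : R) ^+ ds)^-1 * (Ext c s == r)%:R)) [RHS]big_mkcond /=.
apply: eq_bigr => v _; rewrite (bigD1 s) //= [X in _ + X]big1 ?addr0; last first.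
  move=> s' /negPf ne; rewrite /prot_out.
  by case: ifP => _; rewrite ?xpair_eqE /= ?ne ?andbF /= mulr0.
rewrite /prot_out eqxx andbT; case: (accept v) => /=; last first.
  by rewrite ?xpair_eqE /= mulr0.
case: (zvec_of v == zv); last by rewrite andbF mulr0.
by rewrite ?xpair_eqE ?eqxx /= ?andbT ?eqxx ?andbT mulrA.
Qed.

Lemma sum_input_joint : \sum_y input_joint y = 1.
Proof.
case: muH => -[_ <-] _; rewrite sum_pair [RHS]sum_pair; apply: eq_bigr => e _.
by rewrite [RHS](partition_big (@zvec_of Nb k) predT).
Qed.

Lemma soundness_bound : eps <= 1 ->
  strong_extractor Ext sigma eps_ext ->
  sigma <= m%:R + (1 + beta) / beta * log2 eps ->
  2^-1 * \sum_x `|extracted Ext pass_joint x - ideal pass_joint x| <= eps.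
Proof.
move=> eps1 ext sm; set p := \sum_x pass_joint x.
have J0 x : 0 <= pass_joint x by apply: sumr_ge0 => v _; exact: in_H_ge0.
have Jg0 x : 0 <= good_joint x by apply: sumr_ge0 => v _; exact: in_H_ge0.
have half0 : 0 <= 2^-1 :> R by rewrite invr_ge0 ler0n.
(* If passing has probability [p < eps], both terms have mass [p], and half their L1 distance is at
   most [p]. *)
case: (ltP p eps) => [pe|ep].
  apply: le_trans (ltW pe).
  apply: (@le_trans _ _ (2^-1 * (p + p))); last by rewrite (_ : 2^-1 * (p + p) = p) //; field.
  have pX : p = \sum_x extracted Ext pass_joint x by rewrite sum_extracted.
  have pI : p = \sum_x @ideal _ _ ds kout _ pass_joint x by rewrite sum_ideal.
  rewrite ler_wpM2l // {1}pX pI.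
  rewrite -big_split ler_sum //= => x _; rewrite (le_trans (ler_normB _ _)) // !ger0_norm //.
    by rewrite mulr_ge0 ?invr_ge0 ?exprn_ge0 ?sumr_ge0.
  by apply: sumr_ge0 => c _; rewrite !mulr_ge0 ?invr_ge0 ?exprn_ge0.
have room : 1 <= #|{: bits m}|%:R * (2 `^ (- sigma) * eps).
  by rewrite card_bits; apply: (room_le beta0) sm; rewrite eps0.
have M0 y : 0 <= input_joint y by apply: sumr_ge0 => v _; exact: in_H_ge0.
have JM y : \sum_c pass_joint (c, y) <= input_joint y.
  rewrite pass_joint_marginal /input_joint big_mkcond [leRHS]big_mkcond ler_sum //= => v _.
  by case: accept; case: ifP => //= _; exact: in_H_ge0.
apply: le_trans (extracted_ideal_le ext Jg0 good_le_pass good_joint_le M0 sum_input_joint JM room eps0 ep) _.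
by rewrite -[leRHS](subrK eps_ext) lerD2r bad_joint_le.
Qed.
End Soundness.

Unset Implicit Arguments.

Theorem theorem2 (R : realType) (k kout : nat) (eps : R) (Nb : nat) (beta : R)
    (G : 'I_Nb -> seq (block k) -> block k -> R)
    (ds : nat) (Ext : bits (Nb * 2 ^ k * 2) -> bits ds -> bits kout)
    (sigma eps_ext : R) :
  (1 <= k)%N -> (1 <= kout)%N -> 0 < eps <= 1 -> 0 < beta ->
  (forall (i : 'I_Nb) (h : seq (block k)), block_PEF beta (G i h)) ->
  eps_ext < eps ->
  strong_extractor Ext sigma eps_ext ->
  sigma <= (Nb * 2 ^ k * 2)%N%:R + (1 + beta) / beta * log2 eps ->
  eps_sound beta eps sigma eps_ext G Ext.
Proof.
move=> _ _ /andP[eps0 eps1] beta0 Gpef eps_extP ext sm E mu muH.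
pose J := pass_joint eps beta G sigma eps_ext mu.
have J0 x : 0 <= J x by apply: sumr_ge0 => v _; exact: in_H_ge0.
have passE : prob_pass beta eps sigma eps_ext G Ext mu = \sum_x J x.
  rewrite -(sum_extracted Ext J); apply: eq_bigr => -[[r s] [zv e]] _.
  exact: pi_mu_pass.
(* When passing has probability 0 the left side is 0, so any distribution serves as [nu]; the
   unconditional law of inputs and [E] is taken. *)
case: (eqVneq (\sum_x J x) 0) => [p0|p0].
  exists (input_joint mu); split; last by rewrite passE p0 mulr0 ltW.
  split=> [y|]; first by apply: sumr_ge0 => v _; exact: in_H_ge0.
  exact: sum_input_joint.
have p_gt0 : 0 < \sum_x J x by rewrite lt0r p0 sumr_ge0.
(* Here [nu] is the law of inputs and [E] conditional on passing. Multiplying by the passing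
   probability then undoes both normalisations. *)
exists (fun y => (\sum_c J (c, y)) / \sum_x J x); split.
  split=> [y|]; first by rewrite divr_ge0 ?sumr_ge0.
  by rewrite -mulr_suml -sum_pair mulfV.
rewrite passE; apply: le_trans (soundness_bound eps0 beta0 eps_extP Gpef muH eps1 ext sm).
rewrite /TV -mulrA ler_wpM2l ?invr_ge0 ?ler0n // mulr_suml ler_sum // => -[[r s] [zv e]] _.
by rewrite pi_mu_pass -[X in _ * X <= _](gtr0_norm p_gt0) -normrM mulrBl divfK // -mulrA divfK.
Qed.
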